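(* Suppose $\Lambda(X)=1$ and $\Lambda=\sum_{i\in\mathcal I}\lambda_i\Lambda_i$ on $\mathcal B$, where $\mathcal I$ is an at most countable set, $(\Lambda_i)_{i\in\mathcal I}$ is a family of distinct ergodic probability measures on $\mathcal B$, and $(\lambda_i)_{i\in\mathcal I}\subset(0,1]$. For each $i\in\mathcal I$ let $Z_i$ be a measurable version of the Radon-Nikodym derivative $d\Lambda_i/d\phi_0$ (on $\mathcal A_0$) and let $m_i$ be the $\Lambda_i$-essential infimum of $Z_i$. Suppose there exists $\gamma>1$ such that $\int Z^{\gamma-1}d\Lambda<\infty$. Let $Q\in\mathcal B$. Then $$\mathcal H_\alpha(\Lambda,\phi_0)(Q)=\sum_{i\in\mathcal I}\lambda_i^\alpha m_i^{\alpha-1}\Lambda_i(Q)\quad\text{for all }1\le\alpha\le\gamma.$$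
   Context: Setting. Let $X$ be a set, $S:X\to X$ a bijection, $\mathcal A$ a $\sigma$-algebra on $X$, $\mathcal A_0$ the $\sigma$-algebra generated by $\bigcup_{i\ge 0}S^{-i}\mathcal A$, $\mathcal B$ the $\sigma$-algebra generated by $\bigcup_{i\in\mathbb Z}S^{-i}\mathcal A$, and $\mathcal A_m:=S^{-m}\mathcal A_0=\{S^{-m}A:A\in\mathcal A_0\}$ for integers $m\le 0$ (so $\mathcal A_0\subset\mathcal A_{-1}\subset\cdots$). Let $\phi_0$ be a finite positive measure on $\mathcal A_0$, and $\Lambda$ a finite positive measure on $\mathcal A_0$ with $\Lambda\circ S^{-1}=\Lambda$ and $\Lambda\ll\phi_0$; let $Z\ge0$ be an $\mathcal A_0$-measurable version of $d\Lambda/d\phi_0$. For $Q\subset X$ let $\mathcal C(Q)$ be the set of all sequences $(A_m)_{m\le0}$ with $A_m\in\mathcal A_m$ for all $m\le 0$ and $Q\subset\bigcup_{m\le0}A_m$. The symbol $\Lambda$ also denotes the unique $S$-invariant measure on $\mathcal B$ extending $\Lambda$. ''Ergodic'' means $S$-invariant and ergodic with respect to $S$. Conventions: $y^x:=e^{x\log y}$ with $0\log0:=0$, thus $0^0:=1$. For $\alpha\ge0$ and $Q\subset X$: $\mathcal H_\alpha(\Lambda,\phi_0)(Q):=\inf_{(A_m)\in\mathcal C(Q)}\sum_{m\le0}\int_{S^mA_m}Z^\alpha d\phi_0$. *)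

(* Defs.v *)
From HB Require Import structures.
From mathcomp Require Import all_boot all_order all_algebra.
From mathcomp Require Import all_classical all_reals all_analysis.

Set Implicit Arguments.
Unset Strict Implicit.
Unset Printing Implicit Defensive.

Import Order.TTheory GRing.Theory Num.Theory.
Import numFieldNormedType.Exports.

Local Open Scope classical_set_scope.
Local Open Scope ring_scope.

(* [set_iter S i B] is S^i B. For a bijection S the image under S^i is the
   preimage under S^(-i), so no explicit inverse of S is needed. *)
Definition set_iter (X : Type) (S : X -> X) (i : int) (B : set X) : set X :=
  match i with
  | Posz n => iter n S @` B
  | Negz n => iter n.+1 S @^-1` B
  end.

Definition gen_future (X : Type) (S : X -> X) (A : set (set X)) :
    set (set X) :=
  \bigcup_(i in [set i : int | 0 <= i]) [set set_iter S (- i) B | B in A].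

Definition gen_full (X : Type) (S : X -> X) (A : set (set X)) :
    set (set X) :=
  \bigcup_(i in [set: int]) [set set_iter S (- i) B | B in A].

(* X equipped with the sigma-algebra A_0, respectively B. Both types are
   convertible to X. *)
Notation future_space S A := (g_sigma_algebraType (gen_future S A)).
Notation full_space S A := (g_sigma_algebraType (gen_full S A)).

Definition sigma_shift (X : Type) (S : X -> X) (A : set (set X)) (m : int) :
    set (set X) :=
  [set set_iter S (- m) B | B in <<s gen_future S A >>].

(* Sequences indexed by the integers m <= 0 are encoded as functions on nat,
   with n standing for the index m = - n. *)
Definition covers (X : Type) (S : X -> X) (A : set (set X)) (Q : set X) :
    set (nat -> set X) :=
  [set C | (forall n : nat, sigma_shift S A (- n%:Z) (C n)) /\
           Q `<=` \bigcup_n C n].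

(* [powR] satisfies 0 `^ 0 = 1 and 0 `^ a = 0 for a != 0. *)
Definition H_alpha (R : realType) (X : pointedType) (S : X -> X)
    (A : set (set X)) (phi0 : {finite_measure set (future_space S A) -> \bar R})
    (Z : X -> R) (alpha : R) (Q : set X) : \bar R :=
  ereal_inf
    [set (\sum_(0 <= n <oo)
            \int[phi0]_(x in set_iter S (- n%:Z) (C n)) (Z x `^ alpha)%:E)%E
    | C in covers S A Q].

Definition RN_version (d : measure_display) (T : measurableType d)
    (R : realType) (nu mu : set T -> \bar R) (f : T -> R) : Prop :=
  measurable_fun [set: T] f /\
  forall B, measurable B -> nu B = (\int[mu]_(x in B) (f x)%:E)%E.

Definition shift_invariant (d : measure_display) (T : measurableType d)
    (R : realType) (S : T -> T) (mu : set T -> \bar R) : Prop :=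
  forall B, measurable B -> mu (S @^-1` B) = mu B.

Definition shift_ergodic (d : measure_display) (T : measurableType d)
    (R : realType) (S : T -> T) (P : probability T R) : Prop :=
  shift_invariant S P /\
  forall B, measurable B -> S @^-1` B = B -> P B = 0%E \/ P B = 1%E.

(* Library measures are functions on all subsets; only their values on
   measurable sets are meaningful. *)
Definition same_measure (d : measure_display) (T : measurableType d)
    (R : realType) (mu nu : set T -> \bar R) : Prop :=
  forall B, measurable B -> mu B = nu B.

(* Main.v *)
(* For alpha >= 1 let c(E) be the integral of Z^alpha over E with respect to
   phi0, so that the cost of a cover (C_n) is the sum of the c(S^-n C_n). Distinct
   ergodic measures are mutually singular already on A_0, so the Lambda_i live on
   disjoint sets B_i of A_0, on which Z = lambda_i Z_i. Put
   w_i = (lambda_i m_i)^(alpha-1) and nu = sum_i lambda_i w_i Lambda_i. On B_i one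
   has Z^(alpha-1) >= w_i almost everywhere, hence c >= nu on A_0; as nu is
   S-invariant, every cover of Q costs at least nu(Q).

   Conversely, by outer regularity Q is contained in a countable union U of sets
   of the A_m with nu(U) close to nu(Q). Let D be the union of the sets
   B_i /\ {Z^(alpha-1) <= w_i + delta}, on which c <= nu + delta Lambda. Points of
   U whose backward orbit visits D infinitely often are covered, at cost at most
   nu(U) + delta, by sorting them according to a first visit to D. The backward orbit of
   any other point eventually avoids D; by ergodicity almost no forward orbit
   avoids D, so these points are covered at arbitrarily small cost. *)

Require Import Defs.
From HB Require Import structures.
From mathcomp Require Import all_boot all_order all_algebra.
From mathcomp Require Import all_classical all_reals all_analysis.
From mathcomp Require Import measurable_realfun ess_sup_inf.
From mathcomp Require Import lra.
Import Order.TTheory GRing.Theory Num.Theory.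
Import numFieldNormedType.Exports.
Local Open Scope classical_set_scope.
Local Open Scope ring_scope.

Set Implicit Arguments.
Unset Strict Implicit.
Unset Printing Implicit Defensive.

(** * Radon-Nikodym versions and ergodicity *)

Section radon_nikodym_versions.
Context d (T : measurableType d) (R : realType).
Variable mu : {measure set T -> \bar R}.
Implicit Types (f g : T -> R) (nu : set T -> \bar R).
Local Open Scope ereal_scope.

(** A difference of extended reals is finite only if both terms are, so finiteness of [nu setT]
    bounds the integrals of the positive and the negative part of [f], whose sign is not
    prescribed. *)
Lemma RN_version_integrable nu f : RN_version nu mu f ->
  nu setT \is a fin_num -> mu.-integrable setT (EFin \o f).
Proof.
move=> [mf nuf]; rewrite nuf// integralE fin_numB => /andP[fp fn].
have mEf : measurable_fun setT (EFin \o f) by exact/measurable_EFinP.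
apply/integrableP; split => //.
rewrite (_ : (fun x => _) = (EFin \o f)^\+ \+ (EFin \o f)^\-); last first.
  exact: fune_abse.
rewrite ge0_integralD//; last 2 first.
- exact: measurable_funepos.
- exact: measurable_funeneg.
by rewrite lte_add_pinfty// -ge0_fin_numE// integral_ge0.
Qed.

Lemma RN_version_null nu f E : RN_version nu mu f -> measurable E ->
  mu E = 0 -> nu E = 0.
Proof.
move=> [mf nuf] mE E0; rewrite nuf// null_set_integral//.
exact/measurable_funTS/measurable_EFinP.
Qed.

Variables (nu1 nu2 : set T -> \bar R) (f1 f2 : T -> R).
Hypotheses (nuf1 : RN_version nu1 mu f1) (nuf2 : RN_version nu2 mu f2).
Hypotheses (fin1 : nu1 setT \is a fin_num) (fin2 : nu2 setT \is a fin_num).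

Let int1 : mu.-integrable setT (EFin \o f1).
Proof. exact: RN_version_integrable nuf1 fin1. Qed.
Let int2 : mu.-integrable setT (EFin \o f2).
Proof. exact: RN_version_integrable nuf2 fin2. Qed.

Lemma RN_version_le E : measurable E -> (forall x, E x -> (f1 x <= f2 x)%R) ->
  nu1 E <= nu2 E.
Proof.
move=> mE f12; rewrite nuf1.2// nuf2.2//.
apply: le_integral => //.
- exact: integrableS int1.
- exact: integrableS int2.
- by move=> x /set_mem Ex; rewrite lee_fin f12.
Qed.

(** The integral over [E] of the positive function [f2 - f1] is at most 0, hence zero, and this
    forces [E] to be null. *)
Lemma RN_version_lt_null E : measurable E ->
  (forall x, E x -> (f1 x < f2 x)%R) -> nu2 E <= nu1 E -> mu E = 0.
Proof.
move=> mE f12 le21.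
have i1 : mu.-integrable E (EFin \o f1) by exact: integrableS int1.
have i2 : mu.-integrable E (EFin \o f2) by exact: integrableS int2.
have : \int[mu]_(x in E) ((EFin \o f2) x - (EFin \o f1) x) <= 0.
  rewrite integralB//= -nuf1.2// -nuf2.2// leeBlDr ?add0e//.
  by rewrite nuf1.2//; exact: integrable_fin_num.
rewrite le_eqVlt ltNge integral_ge0 ?orbF; last first.
  by move=> x Ex /=; rewrite -EFinB lee_fin subr_ge0 ltW// f12.
move=> /eqP I0.
have mfB : measurable_fun E (fun x => (EFin \o f2) x - (EFin \o f1) x).
  by apply: emeasurable_funB; [exact: (measurable_int mu)|
                               exact: (measurable_int mu)].
have [+ _] := ae_eq_integral_abs mu mE mfB.
rewrite (_ : \int[mu]_(x in E) _ =
    \int[mu]_(x in E) ((EFin \o f2) x - (EFin \o f1) x)); last first.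
  apply: eq_integral => x /set_mem Ex; rewrite gee0_abs//= -EFinB lee_fin.
  by rewrite subr_ge0 ltW// f12.
move=> /(_ I0) [N [mN N0 sN]].
apply: (subset_measure0 mE mN _ N0) => x Ex; apply: sN => /= /(_ Ex).
rewrite -EFinB => -[] /eqP; rewrite subr_eq0 => /eqP e.
by have := f12 _ Ex; rewrite e ltxx.
Qed.

End radon_nikodym_versions.

Section ergodic.
Context d (T : measurableType d) (R : realType) (S : T -> T).
Hypothesis mS : forall B : set T, measurable B -> measurable (S @^-1` B).
Local Open Scope ereal_scope.

Lemma measurable_iter_preimage n (B : set T) : measurable B ->
  measurable (iter n S @^-1` B).
Proof.
move=> mB; elim: n => [|n IH]; first by rewrite (_ : _ @^-1` _ = B).
rewrite (_ : _ @^-1` _ = S @^-1` (iter n S @^-1` B)); first exact: mS.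
by apply/seteqP; split => x /=; rewrite -iterSr.
Qed.

Lemma shift_invariant_iter (mu : set T -> \bar R) n (B : set T) :
  shift_invariant S mu -> measurable B -> mu (iter n S @^-1` B) = mu B.
Proof.
move=> Smu mB; elim: n => [|n IH]; first by rewrite (_ : _ @^-1` _ = B).
rewrite (_ : _ @^-1` _ = S @^-1` (iter n S @^-1` B)).
  by rewrite Smu//; exact: measurable_iter_preimage.
by apply/seteqP; split => x /=; rewrite -iterSr.
Qed.

(* [F] below is the set of points whose orbit never leaves [E]; it is contained
   in its own preimage, hence equal up to a null set to the strictly invariant
   union of its iterated preimages. *)
Lemma ergodic_subinvariant (P : probability T R) (E : set T) :
  shift_ergodic S P -> measurable E -> P (E `\` S @^-1` E) = 0 ->
  P E = 0 \/ P E = 1.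
Proof.
move=> [SP erg] mE E0.
have mi := measurable_iter_preimage.
pose F := \bigcap_n (iter n S @^-1` E).
have mF : measurable F by apply: bigcapT_measurable => n; exact: mi.
have FS : F `<=` S @^-1` F by move=> x Fx n _ /=; rewrite -iterSr; exact: Fx.
(* A point of [E] outside [F] is in [E] at some time and not at the next, so these points are
   covered by iterated preimages of a null set. *)
have EF : P (E `\` F) = 0.
  apply/eqP; rewrite -measure_le0.
  apply: (@le_trans _ _
      (\sum_(0 <= n <oo) P (iter n S @^-1` (E `\` S @^-1` E)))).
    apply: measure_sigma_subadditive.
    - by move=> n; apply: mi; apply: measurableD => //; exact: mS.
    - exact: measurableD.
    - move=> x [Ex /existsNP[n /not_implyP[_ nE]]].
      elim: n nE => [//|n IH] nE.
      have [En|/IH//] := pselect (E (iter n S x)).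
      by exists n.
  rewrite eseries0// => n _ _; rewrite shift_invariant_iter//.
  by apply: measurableD => //; exact: mS.
pose G := \bigcup_n (iter n S @^-1` F).
have mG : measurable G by apply: bigcupT_measurable => n; exact: mi.
have SG : S @^-1` G = G.
  apply/seteqP; split=> x [n _ /= Fn].
    by exists n.+1 => //; rewrite /preimage /mkset iterSr.
  by exists n => //; rewrite /preimage /= -iterSr; exact: FS Fn.
(* [G] is an increasing union of preimages of [F], all of measure [P F]. *)
have PG : P G = P F.
  apply/eqP; rewrite eq_le; apply/andP; split; last first.
    by apply: le_measure; rewrite ?inE// => x Fx; exists 0%N.
  have nd : {homo (fun n => iter n S @^-1` F) : n m / (n <= m)%N >-> (n <= m)%O}.
    move=> n m nm; apply/subsetPset => x /= Fx; rewrite -(subnK nm) iterD.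
    elim: (m - n)%N => [//|k IH]; exact: FS IH.
  have := nondecreasing_cvg_mu (mu := P) (fun n => mi n _ mF) mG nd.
  move=> /(cvg_lim (@ereal_hausdorff R)) <-; apply: lime_le.
    apply: ereal_nondecreasing_is_cvgn => n m nm.
    by apply: le_measure; rewrite ?inE; [exact: mi..|exact/subsetPset/nd].
  by near=> n; rewrite /= shift_invariant_iter.
have PE : P E = P F.
  apply/eqP; rewrite eq_le; apply/andP; split.
    rewrite (_ : E = F `|` (E `\` F)).
      have -> : P F = P F + P (E `\` F) by rewrite EF adde0.
      by apply: measureU2 => //; exact: measurableD.
    by rewrite setDUK// => x /(_ 0%N); exact.
  by apply: le_measure; rewrite ?inE// => x /(_ 0%N); exact.
by rewrite PE -PG; exact: erg.
Unshelve. all: by end_near.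
Qed.

End ergodic.

(** * Outer regularity *)

Lemma nonincreasing_measure0_lt d (T : measurableType d) (R : realType)
    (mu : {measure set T -> \bar R}) (F : nat -> set T) (e : R) :
  (mu (F 0%N) < +oo)%E -> (forall n, measurable (F n)) ->
  {homo F : n m / (n <= m)%N >-> (m <= n)%O} ->
  mu (\bigcap_n F n) = 0%E -> 0 < e -> exists N, (mu (F N) < e%:E)%E.
Proof.
move=> F0 mF ndF F_0 e0.
have /(_ [set y | (y < e%:E)%E])[] :=
  nonincreasing_cvg_mu F0 mF (bigcapT_measurable mF) ndF.
  by rewrite F_0; apply: open_ereal_lt'; rewrite lte_fin.
by move=> N _ /(_ N (leqnn N)) FN; exists N.
Qed.

Section outer_regularity.
Context d (T : measurableType d) (R : realType).
Variables (mu : {measure set T -> \bar R}) (G : set (set T)).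
Hypothesis mu_fin : (mu setT < +oo)%E.
Hypothesis G_measurable : G `<=` measurable.
Hypotheses (G0 : G set0) (GT : G setT).
Hypothesis GI : forall U V, G U -> G V -> G (U `&` V).
Hypothesis G_bigcup : forall U : nat -> set T,
  (forall n, G (U n)) -> G (\bigcup_n U n).
Local Open Scope ereal_scope.

(* The roles of [Q] and its complement are symmetric in [squeezed], which makes
   it stable under complement, unlike outer regularity itself. *)
Let squeezed (Q : set T) := forall e : R, (0 < e)%R ->
  exists U V, [/\ G U, G V, Q `<=` U, ~` Q `<=` V & mu (U `&` V) <= e%:E].

(** [G] admits countable unions but only finite intersections, so the complement is enclosed in a
    finite intersection [W N]. Half of [e] pays for the overlaps of [U n] and [V n], half for the
    tail [D N] of the union. *)
Let squeezed_bigcup (Q : nat -> set T) :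
  (forall n, squeezed (Q n)) -> squeezed (\bigcup_n Q n).
Proof.
move=> sQ e e0.
have e20 : (0 < e / 2)%R by rewrite divr_gt0.
have epos n : (0 < (e / 2) / (2 ^ n.+1)%:R)%R.
  by rewrite divr_gt0// ltr0n expn_gt0.
have /choice[U /choice[V UV]] n := sQ n _ (epos n).
have GU n : G (U n) by have [] := UV n.
have GV n : G (V n) by have [] := UV n.
have QU n : Q n `<=` U n by have [] := UV n.
have QV n : ~` Q n `<=` V n by have [] := UV n.
have mUV n : mu (U n `&` V n) <= ((e / 2) / (2 ^ n.+1)%:R)%:E by have [] := UV n.
have mU n : measurable (U n) by exact: G_measurable.
have mV n : measurable (V n) by exact: G_measurable.
pose W N := \big[setI/setT]_(k < N) V k.
have GW N : G (W N) by rewrite /W; elim/big_ind : _ => //; exact: GI.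
pose UU := \bigcup_n U n.
have mUU : measurable UU by exact: bigcupT_measurable.
pose D N := UU `\` \bigcup_(k in `I_N) U k.
have mbI N : measurable (\bigcup_(k in `I_N) U k) by exact: bigcup_measurable.
have mD N : measurable (D N) by exact: measurableD.
have fin B : measurable B -> mu B < +oo.
  move=> mB; apply: le_lt_trans mu_fin; apply: le_measure; rewrite ?inE//.
have [||||//|N DN] := @nonincreasing_measure0_lt _ _ _ mu D (e / 2) => //.
- exact: fin.
- move=> n m nm; apply/subsetPset => x [UUx nU]; split => // -[k /= kn Uk].
  by apply: nU; exists k => //=; exact: leq_trans nm.
- rewrite (_ : \bigcap_N D N = set0) ?measure0//.
  rewrite -subset0 => x xD; have [[n _ Un] _] := xD 0%N I.
  by have [_] := xD n.+1 I; apply; exists n => //=.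
exists UU, (W N); split => //.
- exact: G_bigcup.
- by apply: subset_bigcup => n _; exact: QU.
- move=> x nQ; rewrite /W -(@bigcap_mkord _ N V) => k _.
  by apply: QV => Qx; apply: nQ; exists k.
- have mUVN : measurable (\bigcup_n (U n `&` V n)).
    by apply: bigcupT_measurable => n; exact: measurableI.
  apply: (@le_trans _ _ (mu (\bigcup_n (U n `&` V n) `|` D N))).
    apply: le_measure; rewrite ?inE.
    + by apply: measurableI => //; exact: G_measurable.
    + exact: measurableU.
    + move=> x [UUx]; rewrite /W -(@bigcap_mkord _ N V) => Vx.
      have [[k kN Uk]|nU] := pselect ((\bigcup_(k in `I_N) U k) x).
        by left; exists k => //; split => //; exact: Vx.
      by right.
  apply: (le_trans (measureU2 _ _ _)) => //.
  rewrite [e]splitr EFinD; apply: leeD; last exact: ltW.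
  apply: (@le_trans _ _ (\sum_(0 <= n <oo) mu (U n `&` V n))).
    apply: measure_sigma_subadditive => //.
    by move=> n; exact: measurableI.
  apply: (@le_trans _ _
      (\sum_(0 <= n <oo) (cst 0 n + ((e / 2) / (2 ^ n.+1)%:R)%:E))).
    by apply: lee_nneseries => // n _; rewrite add0e.
  apply: (le_trans (epsilon_trick _ _ _)) => //; first exact: ltW.
  by rewrite eseries0// add0e.
Qed.

(** The squeezed sets form a sigma-algebra containing [F], and the excess of [U] over a squeezed [Q]
    lies in the overlap of [U] and [V]. *)
Lemma outer_regular_generated (F : set (set T)) (Q : set T) (e : R) :
  F `<=` G -> (forall B, F B -> G (~` B)) -> <<s F >> Q -> (0 < e)%R ->
  exists U, [/\ G U, Q `<=` U & mu U <= mu Q + e%:E].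
Proof.
move=> FG FCG sQ e0.
have sqQ : squeezed Q.
  move: Q sQ; apply: smallest_sub; last first.
    move=> B FB ? ?; exists B, (~` B); split => //; [exact: FG|exact: FCG|].
    by rewrite setICr measure0 lee_fin ltW.
  split.
  - move=> ? ?; exists set0, setT; split => //.
    by rewrite set0I measure0 lee_fin ltW.
  - move=> B sB e' e'0; have [U [V [GU GV BU BV UV]]] := sB _ e'0.
    by exists V, U; split => //; rewrite ?setTD ?setCK// setIC.
  - exact: squeezed_bigcup.
have [U [V [GU GV QU QV UV]]] := sqQ _ e0.
have mQ : measurable Q.
  move: Q sQ {sqQ QU QV}; apply: smallest_sub; first exact: sigma_algebra_measurable.
  by apply: subset_trans G_measurable.
exists U; split => //; rewrite -(setDUK QU).
have mU := G_measurable GU.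
apply: (le_trans (measureU2 _ _ _)) => //; first exact: measurableD.
rewrite leeD2l//; apply: le_trans UV; apply: le_measure; rewrite ?inE.
- exact: measurableD.
- by apply: measurableI => //; exact: G_measurable.
- by move=> x [Ux nQ]; split => //; exact: QV.
Qed.

End outer_regularity.

(** * The filtration of a bijective shift *)

Lemma iter_cancel (Y : Type) (f g : Y -> Y) n : cancel f g ->
  cancel (iter n f) (iter n g).
Proof. by move=> fK; elim: n => // n IH x; rewrite iterSr iterS fK. Qed.

Section shift_spaces.
Variables (X : pointedType) (S T : X -> X) (A : set (set X)).
Hypotheses (SK : cancel S T) (TK : cancel T S).

Lemma image_iterE n (B : set X) : iter n S @` B = iter n T @^-1` B.
Proof.
apply/seteqP; split=> [_ [x Bx <-]|x Bx] /=; first by rewrite iter_cancel.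
by exists (iter n T x) => //; rewrite iter_cancel.
Qed.

Lemma set_iterNE n (B : set X) : set_iter S (- n%:Z) B = iter n S @^-1` B.
Proof. by case: n => [|n]; rewrite ?oppr0 /set_iter//= image_id. Qed.

Lemma sigma_shiftNE n (B : set X) :
  sigma_shift S A (- n%:Z) B <-> <<s gen_future S A >> (iter n S @^-1` B).
Proof.
rewrite /sigma_shift opprK; split=> [[C FC <-]|FB] /=.
  rewrite image_iterE (_ : _ @^-1` _ = C)//.
  by apply/seteqP; split => x /=; rewrite iter_cancel.
exists (iter n S @^-1` B) => //; rewrite image_iterE.
by apply/seteqP; split => x /=; rewrite iter_cancel.
Qed.

Lemma gen_future_full : gen_future S A `<=` gen_full S A.
Proof. by move=> B [i _ ?]; exists i. Qed.

Lemma measurable_future_full (B : set X) :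
  <<s gen_future S A >> B -> <<s gen_full S A >> B.
Proof. by apply: sub_sigma_algebra2; exact: gen_future_full. Qed.

Lemma set_iter_preimageS (i : int) (B : set X) :
  S @^-1` (set_iter S (- i) B) = set_iter S (- (i + 1)) B.
Proof.
case: i => [n|n].
  rewrite -PoszD !set_iterNE addn1.
  by apply/seteqP; split => x /=; rewrite -iterSr.
rewrite NegzE opprK (_ : - (- n.+1%:Z + 1) = n%:Z); last first.
  by rewrite opprD opprK -addn1 PoszD addrK.
by rewrite /set_iter !image_iterE; apply/seteqP; split => x /=; rewrite -iterS iterSr SK.
Qed.

Lemma set_iter_preimageT (i : int) (B : set X) :
  T @^-1` (set_iter S (- i) B) = set_iter S (- (i - 1)) B.
Proof.
rewrite -[in LHS](subrK 1 i) -set_iter_preimageS.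
by apply/seteqP; split => x /=; rewrite TK.
Qed.

Lemma measurable_preimage_gen (F : set (set X)) (f : X -> X) (B : set X) :
  (forall B, F B -> F (f @^-1` B)) -> <<s F >> B -> <<s F >> (f @^-1` B).
Proof.
move=> Ff sB; have : <<s preimage_set_system setT f F >> (f @^-1` B).
  by rewrite g_sigma_preimageE; exists B => //; rewrite setTI.
apply: sub_sigma_algebra2 => _ [C FC <-]; rewrite setTI; exact: Ff.
Qed.

Lemma measurable_future_preimage (B : set X) :
  <<s gen_future S A >> B -> <<s gen_future S A >> (S @^-1` B).
Proof.
apply: measurable_preimage_gen => C [i /= i0 [D AD <-]].
rewrite set_iter_preimageS; exists (i + 1); first by rewrite /= addr_ge0.
by exists D.
Qed.

Lemma measurable_full_preimage (B : set X) :
  <<s gen_full S A >> B -> <<s gen_full S A >> (S @^-1` B).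
Proof.
apply: measurable_preimage_gen => C [i _ [D AD <-]].
by rewrite set_iter_preimageS; exists (i + 1) => //; exists D.
Qed.

Lemma measurable_full_preimageV (B : set X) :
  <<s gen_full S A >> B -> <<s gen_full S A >> (T @^-1` B).
Proof.
apply: measurable_preimage_gen => C [i _ [D AD <-]].
by rewrite set_iter_preimageT; exists (i - 1) => //; exists D.
Qed.

(* [stage n] is the sigma-algebra A_(-n). *)
Definition stage n : set (set X) :=
  [set B | <<s gen_future S A >> (iter n S @^-1` B)].

Lemma stageT n : stage n setT. Proof. exact: (@measurableT _ (future_space S A)). Qed.

Lemma stage0 n : stage n set0.
Proof. exact: (@measurable0 _ (future_space S A)). Qed.

Lemma stageI n B C : stage n B -> stage n C -> stage n (B `&` C).
Proof. exact: (@measurableI _ (future_space S A)). Qed.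

Lemma stageD n B C : stage n B -> stage n C -> stage n (B `\` C).
Proof. exact: (@measurableD _ (future_space S A)). Qed.

Lemma stage_bigcup n (B : nat -> set X) (P : set nat) :
  (forall k, P k -> stage n (B k)) -> stage n (\bigcup_(k in P) B k).
Proof.
move=> sB; rewrite /stage /= preimage_bigcup.
exact: (@bigcup_measurable _ (future_space S A)).
Qed.

Lemma le_stage m n B : (m <= n)%N -> stage m B -> stage n B.
Proof.
move=> mn; rewrite /stage /= => sB.
rewrite -(subnK mn); elim: (n - m)%N => [//|k IH].
rewrite addSn (_ : _ @^-1` _ = S @^-1` (iter (k + m) S @^-1` B)).
  exact: measurable_future_preimage.
by apply/seteqP; split => x /=; rewrite -iterSr.
Qed.

Lemma preimage_iterK n (B : set X) : iter n S @^-1` (iter n T @^-1` B) = B.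
Proof. by apply/seteqP; split => x /=; rewrite iter_cancel. Qed.

Lemma preimage_iterVK n (B : set X) : iter n T @^-1` (iter n S @^-1` B) = B.
Proof. by apply/seteqP; split => x /=; rewrite iter_cancel. Qed.

Lemma stage_preimage n B : <<s gen_future S A >> B -> stage n (iter n T @^-1` B).
Proof. by rewrite /stage /= preimage_iterK. Qed.

Lemma stage_full n B : stage n B -> <<s gen_full S A >> B.
Proof.
rewrite /stage /= => /measurable_future_full.
rewrite -[in X in _ -> X](preimage_iterVK n B); move: (_ @^-1` B) => C.
elim: n => [//|n IH] sC.
rewrite (_ : _ @^-1` _ = T @^-1` (iter n T @^-1` C)).
  by apply: measurable_full_preimageV; exact: IH.
by apply/seteqP; split => x /=; rewrite -iterSr.
Qed.

(** A generator S^-i C with i >= 0 is already in A_0; for i < 0 it enters at stage |i|, where the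
    preimage under S^|i| gives back [C]. *)
Lemma gen_full_stage B : gen_full S A B -> exists n, stage n B.
Proof.
move=> [i _ [C AC <-]].
have sC j : (0 <= j)%R -> <<s gen_future S A >> (set_iter S (- j) C).
  by move=> j0; apply: sub_gen_smallest; exists j => //; exists C.
have [/sC|/ltW i0] := leP 0 i; first by exists 0%N.
exists `|i|%N; rewrite /stage /= -(ler0_norm i0) -abszE /= image_iterE.
by rewrite preimage_iterK -[C](image_id) -[X in X @` _]/(iter 0 S); exact: (sC 0).
Qed.

(** The unions of admissible covering sequences; they act as the open sets for outer regularity. *)
Definition open_system : set (set X) :=
  [set U | exists2 C : nat -> set X, forall n, stage n (C n) & U = \bigcup_n C n].

Lemma stage_open n B : stage n B -> open_system B.
Proof.
move=> sB; exists (fun m => if m == n then B else set0).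
  by move=> m; case: eqP => [->//|_]; exact: stage0.
apply/seteqP; split=> [x Bx|x [m _]]; first by exists n => //; rewrite eqxx.
by case: eqP.
Qed.

Lemma open_system_bigcup (U : nat -> set X) :
  (forall n, open_system (U n)) -> open_system (\bigcup_n U n).
Proof.
move=> oU; have /choice[C UC] n : exists C : nat -> set X,
    (forall n, stage n (C n)) /\ U n = \bigcup_k C k.
  by have [C sC ->] := oU n; exists C.
exists (fun n => \bigcup_k C k n).
  by move=> n; apply: stage_bigcup => k _; exact: (UC k).1.
apply/seteqP; split=> x.
  by move=> [n _]; rewrite (UC n).2 => -[k _ Ckx]; exists k => //; exists n.
move=> [n _ [k _ Ckx]]; exists k => //; rewrite (UC k).2; by exists n.
Qed.

Lemma open_systemI U V : open_system U -> open_system V -> open_system (U `&` V).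
Proof.
move=> [C sC ->] [D sD ->].
(* Partial unions make both memberships available at the common index [maxn n m]. *)
exists (fun n => (\bigcup_(k in `I_n.+1) C k) `&` (\bigcup_(k in `I_n.+1) D k)).
  move=> n; apply: stageI; apply: stage_bigcup => k /= kn.
    exact: le_stage (sC k).
  exact: le_stage (sD k).
apply/seteqP; split=> x.
  move=> [[n _ Cx] [m _ Dx]]; exists (maxn n m) => //; split.
    by exists n => //=; rewrite ltnS leq_maxl.
  by exists m => //=; rewrite ltnS leq_maxr.
by move=> [n _ [[k _ Cx] [l _ Dx]]]; split; [exists k|exists l].
Qed.

(** A generator of B and its complement both lie in some stage, hence are open, which is what the
    general argument asks of generators. *)
Lemma full_outer_regular (R : realType)
    (mu : {measure set (full_space S A) -> \bar R}) (Q : set X) (e : R) :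
  (mu setT < +oo)%E -> <<s gen_full S A >> Q -> 0 < e ->
  exists C : nat -> set X, [/\ forall n, stage n (C n), Q `<=` \bigcup_n C n &
    (mu (\bigcup_n C n) <= mu Q + e%:E)%E].
Proof.
move=> mu_fin mQ e0.
have := @outer_regular_generated _ (full_space S A) R mu open_system mu_fin.
move=> /(_ _ _ _ open_systemI open_system_bigcup (gen_full S A) Q e)[] //.
- move=> _ [C sC ->]; apply: (@bigcupT_measurable _ (full_space S A)) => n.
  exact: stage_full (sC n).
- exact: stage_open (stage0 0).
- exact: stage_open (stageT 0).
- by move=> B /gen_full_stage[n]; exact: stage_open.
- move=> B /gen_full_stage[n sB]; rewrite -setTD.
  by apply: (@stage_open n); apply: stageD => //; exact: stageT.
- by move=> _ [[C sC ->] QU mU]; exists C.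
Qed.

End shift_spaces.

(** * Infimum over covers *)

Section dynamical_outer_measure.
Variables (R : realType) (X : pointedType) (S T : X -> X) (A : set (set X)).
Hypotheses (SK : cancel S T) (TK : cancel T S).
Variable c : {measure set (future_space S A) -> \bar R}.
Local Open Scope ereal_scope.

Local Notation stage := (stage S A).
Local Notation cost C := (\sum_(0 <= n <oo) c (iter n S @^-1` (C n))).

Lemma cost_bigcup (C : nat -> nat -> set X) :
  (forall k n, stage n (C k n)) ->
  cost (fun n => \bigcup_k C k n) <= \sum_(0 <= k <oo) cost (C k).
Proof.
move=> sC.
apply: (@le_trans _ _
    (\sum_(0 <= n <oo) \sum_(0 <= k <oo) c (iter n S @^-1` (C k n)))).
  apply: lee_nneseries => // n _; apply: measure_sigma_subadditive.
  - by move=> k; exact: sC.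
  - by apply: stage_bigcup => k _; exact: sC.
  - by rewrite preimage_bigcup.
by rewrite nneseries_interchange.
Qed.

Lemma cost_single N (B : set X) :
  cost (fun n => if n == N then B else set0) = c (iter N S @^-1` B).
Proof.
rewrite (@nneseriesD1 _ _ N)//.
rewrite eqxx eseries0 ?adde0// => n _ /negbTE ->.
by rewrite preimage_set0 measure0.
Qed.

(** [c] stands for the integral of Z^alpha against phi0, [nu] for the value to be reached, [L] for
    Lambda. *)
Variables nu L : {measure set (full_space S A) -> \bar R}.
Hypothesis c_fin : c setT < +oo.
Hypothesis nu_inv : shift_invariant (S : full_space S A -> full_space S A) nu.
Hypothesis L_inv : shift_invariant (S : full_space S A -> full_space S A) L.
Hypothesis L_fin : L setT <= 1.
Hypothesis nu_le : forall E, <<s gen_future S A >> E -> nu E <= c E.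
Hypothesis c_le : forall delta : R, (0 < delta)%R -> exists D,
  [/\ <<s gen_future S A >> D,
      (forall E, <<s gen_future S A >> E -> E `<=` D ->
         c E <= nu E + delta%:E * L E) &
      c (\bigcap_n iter n S @^-1` (~` D)) = 0].

Let mfull n (B : set X) : stage n B -> @measurable _ (full_space S A) B.
Proof. by move=> sB; exact: (stage_full SK TK sB). Qed.

Let invE (mu : set X -> \bar R) n (B : set X) :
  shift_invariant (S : full_space S A -> full_space S A) mu ->
  stage n B -> mu (iter n S @^-1` B) = mu B.
Proof.
move=> mu_inv sB.
apply: (@shift_invariant_iter _ (full_space S A)) => //.
  exact: measurable_full_preimage SK TK.
exact: mfull sB.
Qed.

(** Invariance replaces [nu (C n)] by the measure of the n-th preimage, which lies in A_0, where
    [nu_le] applies. *)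
Lemma nu_le_cost (C : nat -> set X) (Q : set X) : <<s gen_full S A >> Q ->
  (forall n, stage n (C n)) -> Q `<=` \bigcup_n C n -> nu Q <= cost C.
Proof.
move=> mQ sC QC; apply: (@le_trans _ _ (\sum_(0 <= n <oo) nu (C n))).
  by apply: measure_sigma_subadditive => // n; exact: mfull (sC n).
apply: lee_nneseries => // n _; rewrite -(invE nu_inv (sC n)).
by apply: nu_le; exact: sC.
Qed.

(* [C n] consists of the points x for which n is the first time such that
   S^-n x is in [D] and x is in some [U k] with k <= n. *)
Lemma first_hit_cover (D : set X) (delta : R) (U : nat -> set X) :
  (0 < delta)%R -> <<s gen_future S A >> D ->
  (forall E, <<s gen_future S A >> E -> E `<=` D ->
    c E <= nu E + delta%:E * L E) ->
  (forall n, stage n (U n)) ->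
  exists C, [/\ forall n, stage n (C n),
    (forall x, (\bigcup_n U n) x ->
      (forall k, exists2 n, (k <= n)%N & D (iter n T x)) -> (\bigcup_n C n) x) &
    cost C <= nu (\bigcup_n U n) + delta%:E].
Proof.
move=> delta0 mD cD sU.
(* The restriction to k <= n keeps [B n] in [stage n]. It loses nothing for points that visit [D]
   infinitely often, as they do so at some time n >= k. *)
pose B n := iter n T @^-1` D `&` \bigcup_(k in `I_n.+1) U k.
have sB n : stage n (B n).
  apply: stageI; first exact: stage_preimage.
  by apply: stage_bigcup => k /= kn; exact: le_stage (sU k).
pose C := seqDU B.
have sC n : stage n (C n).
  rewrite /C /seqDU; apply: stageD => //.
  rewrite -bigcup_mkord; apply: stage_bigcup => k /= kn.
  by apply: (le_stage SK TK _ (sB k)); exact: ltnW.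
exists C; split => //.
  move=> x [k _ Ukx] /(_ k)[n kn Dx].
  rewrite -seqDU_bigcup_eq; exists n => //; split => //.
  by exists k => //=; rewrite ltnS.
have CU : \bigcup_n C n `<=` \bigcup_n U n.
  rewrite -seqDU_bigcup_eq => x [n _ [_ [k _ Ux]]]; by exists k.
have mC n : @measurable _ (full_space S A) (C n) by exact: mfull (sC n).
have mCC : @measurable _ (full_space S A) (\bigcup_n C n).
  exact: bigcupT_measurable.
apply: (@le_trans _ _ (\sum_(0 <= n <oo) (nu (C n) + delta%:E * L (C n)))).
  apply: lee_nneseries => // n _.
  (* The n-th preimage of [C n] lies in A_0 and inside [D], so [cD] applies to it. *)
  rewrite -(invE nu_inv (sC n)) -(invE L_inv (sC n)); apply: cD; first exact: sC.
  by move=> x [[]] /=; rewrite iter_cancel.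
rewrite nneseriesD//; last by move=> n _ _; rewrite mule_ge0// lee_fin ltW.
rewrite nneseriesZl//.
(* Since the [C n] are disjoint, each series is the measure of one set, and [L_fin] bounds the total
   error by [delta]. *)
have muC (mu : {measure set (full_space S A) -> \bar R}) :
    \sum_(0 <= n <oo) mu (C n) = mu (\bigcup_n C n).
  by rewrite measure_semi_bigcup//; exact: trivIset_seqDU.
rewrite !muC; apply: leeD.
  apply: le_measure; rewrite ?inE//.
  by apply: (@bigcupT_measurable _ (full_space S A)) => n; exact: mfull (sU n).
rewrite -[leRHS]mule1 lee_pmul2l ?lte_fin//; apply: le_trans L_fin.
by apply: le_measure; rewrite ?inE.
Qed.

(* If S^-n x avoids [D] for all n >= k, then for every m the first m iterates of
   S^-(k+m) x avoid [D]; the [c]-measure of the set of points whose first m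
   iterates do so tends to 0 with m. A single set of index k + m is enough. *)
Lemma never_hit_cover (D : set X) k (e : R) : (0 < e)%R ->
  <<s gen_future S A >> D -> c (\bigcap_n iter n S @^-1` (~` D)) = 0 ->
  exists C, [/\ forall n, stage n (C n),
    (forall x, (forall n, (k <= n)%N -> ~ D (iter n T x)) ->
      (\bigcup_n C n) x) &
    cost C <= e%:E].
Proof.
move=> e0 mD D0.
pose P m := \bigcap_(j in `I_m.+1) (iter j S @^-1` (~` D)).
have mi j : @measurable _ (future_space S A) (iter j S @^-1` (~` D)).
  apply: (@measurable_iter_preimage _ (future_space S A)).
    exact: measurable_future_preimage SK TK.
  exact: (@measurableC _ (future_space S A)).
have mP m : @measurable _ (future_space S A) (P m).
  by apply: bigcap_measurable => //; exists 0%N.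
have [||||//|m Pm] := @nonincreasing_measure0_lt _ _ _ c P e => //.
- by apply: le_lt_trans c_fin; apply: le_measure; rewrite ?inE.
- move=> m n mn; apply/subsetPset => x Px j /= jm.
  by apply: Px => /=; exact: leq_trans jm _.
- rewrite -D0; congr (c _); apply/seteqP; split => x Px.
    by move=> n _; apply: (Px n) => //=.
  by move=> m _ j _; exact: Px.
exists (fun n => if n == (k + m)%N then iter n T @^-1` P m else set0); split.
- move=> n; case: eqP => [->|_]; last exact: stage0.
  exact: (stage_preimage SK _ (mP m)).
- move=> x xD; exists (k + m)%N => //; rewrite eqxx => j /= jm.
  (* The j-th iterate of S^-(k+m) x is S^-(k+m-j) x, and k+m-j >= k because j <= m. *)
  rewrite ltnS in jm; have jkm : (j <= k + m)%N by exact: leq_trans (leq_addl _ _).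
  rewrite -(subnKC jkm) iterD iter_cancel//; apply: xD.
  by rewrite leq_subRL// addnC leq_add2l.
- under eq_eseriesr => n _.
    rewrite (_ : (if _ then _ else _) =
      if n == (k + m)%N then iter (k + m) T @^-1` P m else set0); last first.
      by case: eqP => // ->.
    over.
  by rewrite cost_single preimage_iterK// ltW.
Qed.

Theorem ereal_inf_covers (Q : set X) : <<s gen_full S A >> Q ->
  ereal_inf [set \sum_(0 <= n <oo) c (set_iter S (- n%:Z) (C n))
            | C in covers S A Q] = nu Q.
Proof.
move=> mQ; apply/eqP; rewrite eq_le; apply/andP; split; last first.
  apply: le_ereal_inf_tmp => _ [C [sC QC] <-].
  under eq_eseriesr do rewrite set_iterNE.
  by apply: nu_le_cost => // n; exact/(sigma_shiftNE _ SK TK).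
apply/lee_addgt0Pr => e e0.
(* One third of [e] goes to outer regularity, one to the first-hit cover, one to all the never-hit
   covers together. *)
have e3 : (0 < e / 3)%R by rewrite divr_gt0.
have nu_fin : nu setT < +oo.
  by apply: le_lt_trans c_fin; apply: nu_le; exact: (@measurableT _ (future_space S A)).
have [U [sU QU nuU]] := full_outer_regular SK TK nu_fin mQ e3.
have [D [mD cD D0]] := c_le e3.
have [C [sC UC costC]] := first_hit_cover e3 mD cD sU.
have epos k : (0 < (e / 3) / (2 ^ k.+1)%:R)%R.
  by rewrite divr_gt0// ltr0n expn_gt0.
have /choice[G G_] k := never_hit_cover k (epos k) mD D0.
(* Index 0 holds the first-hit cover, index k+1 the cover of the points whose backward orbit avoids
   [D] from time k on. *)
pose F k := if k is k'.+1 then G k' else C.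
have sF k n : stage n (F k n) by case: k => [|k] //=; have [] := G_ k.
apply: ge_ereal_inf; exists (cost (fun n => \bigcup_k F k n)); last first.
  apply: (le_trans (cost_bigcup sF)).
  rewrite nneseries_recl//; last by move=> k _; exact: nneseries_ge0.
  rewrite [F 0%N]/=.
  have -> : e = (e / 3 + e / 3 + e / 3)%R by lra.
  rewrite !EFinD !addeA; apply: leeD.
    by apply: (le_trans costC); exact: leeD.
  rewrite -nneseries_addn; last by move=> k; exact: nneseries_ge0.
  apply: (@le_trans _ _
      (\sum_(0 <= k <oo) (cst 0 k + ((e / 3) / (2 ^ k.+1)%:R)%:E))).
    apply: lee_nneseries => [k _ _|k _]; first exact: nneseries_ge0.
    by rewrite add0e addn1; have [] := G_ k.
  apply: (le_trans (epsilon_trick _ _ _)) => //; first exact: ltW.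
  by rewrite eseries0// add0e.
exists (fun n => \bigcup_k F k n).
  split.
    move=> n; apply/(sigma_shiftNE _ SK TK).
    by apply: stage_bigcup => k _; exact: sF.
  move=> x /QU Ux.
  suff [k [n _ Fx]] : exists k, (\bigcup_n F k n) x by exists n => //; exists k.
  have [io|nio] := pselect (forall k, exists2 n, (k <= n)%N & D (iter n T x)).
    by exists 0%N; exact: UC.
  have [k nk] : exists k, forall n, (k <= n)%N -> ~ D (iter n T x).
    move/existsNP: nio => [k nk].
    by exists k => n kn Dx; apply: nk; exists n.
  by exists k.+1; have [_ + _] := G_ k; exact.
by apply: eq_eseriesr => n _; rewrite set_iterNE.
Qed.

End dynamical_outer_measure.

(** * Countable mixtures and mutual singularity *)

Lemma measurable_holds d (T : measurableType d) (b : T -> bool) :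
  measurable_fun setT b -> measurable [set x | b x].
Proof. by move=> mb; have := mb measurableT [set true] I; rewrite setTI; exact. Qed.

Section countable_sums.
Context (R : realType) (I : countType).
Local Open Scope ereal_scope.

(** Transports sums over [I] to series over nat; integers that code no element contribute 0. *)
Lemma esum_pickle (f : I -> \bar R) : (forall i, 0 <= f i) ->
  \esum_(i in [set: I]) f i =
  \sum_(0 <= n <oo) if pickle_inv n is Some i then f i else 0.
Proof.
move=> f0; rewrite nneseries_esumT; last by move=> n; case: pickle_inv.
have inj : set_bij [set: I] (range (@pickle I)) (@pickle I).
  by apply: inj_bij => i j _ _; exact: (pcan_inj (@pickleK_inv I)).
rewrite [RHS](_ : _ = \esum_(n in range (@pickle I))
    if pickle_inv n is Some i then f i else 0).
  rewrite (reindex_esum _ _ _ _ inj); apply: eq_esum => i _.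
  by rewrite pickleK_inv.
rewrite [RHS]esum_mkcond; apply: eq_esum => n _.
case: ifPn => // /negP nr; case nE : (pickle_inv n) => [i|//].
exfalso; apply: nr; rewrite inE; exists i => //.
by have := @pickle_invK I n; rewrite /oapp nE.
Qed.

Lemma ge0_esumZl (r : R) (f : I -> \bar R) : (0 <= r)%R ->
  (forall i, 0 <= f i) ->
  \esum_(i in [set: I]) (r%:E * f i) = r%:E * \esum_(i in [set: I]) f i.
Proof.
move=> r0 f0; rewrite !esum_pickle//; last by move=> i; rewrite mule_ge0.
rewrite -nneseriesZl; last by move=> n _; case: pickle_inv.
by apply: eq_eseriesr => n _; case: pickle_inv => //; rewrite mule0.
Qed.

Lemma esum_single (f : I -> \bar R) i : (forall j, j != i -> f j = 0) ->
  0 <= f i -> \esum_(j in [set: I]) f j = f i.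
Proof.
move=> fj fi; rewrite -(@esum_set1 R I i f fi) [RHS]esum_mkcond.
apply: eq_esum => j _; case: ifPn => // /negP nj; apply: fj.
by apply/eqP => ji; apply: nj; rewrite inE.
Qed.

Lemma measure_countable_bigcup d (T : measurableType d)
    (mu : {measure set T -> \bar R}) (F : I -> set T) :
  (forall i, measurable (F i)) -> trivIset setT F ->
  mu (\bigcup_i F i) = \esum_(i in [set: I]) mu (F i).
Proof.
move=> mF tF; rewrite esum_pickle//.
pose G n := if pickle_inv n is Some i then F i else set0.
rewrite (_ : \bigcup_i F i = \bigcup_n G n); last first.
  apply/seteqP; split => x.
    by move=> [i _ Fix]; exists (pickle i) => //; rewrite /G pickleK_inv.
  by move=> [n _]; rewrite /G; case: pickle_inv => // i Fix; exists i.
have mG n : measurable (G n) by rewrite /G; case: pickle_inv.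
rewrite measure_semi_bigcup//.
- by apply: eq_eseriesr => n _; rewrite /G; case: pickle_inv.
- move=> n m _ _ [x []]; rewrite /G.
  case nE : (pickle_inv n) => [i|//]; case mE : (pickle_inv m) => [j|//] Fi Fj.
  have := tF i j Logic.I Logic.I (ex_intro _ x (conj Fi Fj)).
  have := @pickle_invK I n; have := @pickle_invK I m.
  by rewrite /oapp nE mE => <- <- ->.
- exact: bigcupT_measurable.
Qed.

Lemma measurable_countable_bigcup d (T : measurableType d) (F : I -> set T) :
  (forall i, measurable (F i)) -> measurable (\bigcup_i F i).
Proof.
move=> mF; rewrite (_ : \bigcup_i F i =
    \bigcup_n if pickle_inv n is Some i then F i else set0).
  by apply: bigcupT_measurable => n; case: pickle_inv.
apply/seteqP; split => x.
  by move=> [i _ Fix]; exists (pickle i) => //; rewrite pickleK_inv.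
by move=> [n _]; case: pickle_inv => // i Fix; exists i.
Qed.

(** Integers that code no element carry the zero measure, so that [mixture] is a series of measures
    and inherits their structure. *)
Definition mixture_term d (T : measurableType d) (a : I -> {nonneg R})
    (mu_ : I -> {measure set T -> \bar R}) (n : nat) :
    {measure set T -> \bar R} :=
  if pickle_inv n is Some i then mscale (a i) (mu_ i) else mzero.

Definition mixture d (T : measurableType d) (a : I -> {nonneg R})
    (mu_ : I -> {measure set T -> \bar R}) : {measure set T -> \bar R} :=
  mseries (mixture_term a mu_) 0.

Lemma mixtureE d (T : measurableType d) (a : I -> {nonneg R})
    (mu_ : I -> {measure set T -> \bar R}) (B : set T) :
  mixture a mu_ B = \esum_(i in [set: I]) ((a i)%:num%:E * mu_ i B).
Proof.
rewrite esum_pickle; last by move=> i; rewrite mule_ge0.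
rewrite /mixture /= /mseries; apply: eq_eseriesr => n _.
by rewrite /mixture_term; case: pickle_inv.
Qed.

End countable_sums.

Lemma measure_countable_bigcup0 d (T : measurableType d) (R : realType)
    (I : countType) (mu : {measure set T -> \bar R}) (F : I -> set T) :
  (forall i, measurable (F i)) -> (forall i, mu (F i) = 0%E) ->
  mu (\bigcup_i F i) = 0%E.
Proof.
move=> mF F0; apply/eqP; rewrite -measure_le0.
pose G n := if pickle_inv n is Some i then F i else set0.
apply: (@le_trans _ _ (\sum_(0 <= n <oo) mu (G n))%E).
  apply: measure_sigma_subadditive.
  - by move=> n; rewrite /G; case: pickle_inv.
  - exact: measurable_countable_bigcup.
  - by move=> x [i _ Fix]; exists (pickle i) => //; rewrite /G pickleK_inv.
by rewrite eseries0// => n _ _; rewrite /G; case: pickle_inv.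
Qed.

Section density_measure.
Context d (T : measurableType d) (R : realType).
Variables (mu : {measure set T -> \bar R}) (f : T -> \bar R).
Hypotheses (mf : measurable_fun setT f) (f0 : forall x, (0 <= f x)%E).

Definition density_measure of measurable_fun setT f & (forall x, (0 <= f x)%E) :=
  fun B => (\int[mu]_(x in B) f x)%E.

Local Notation nu := (density_measure mf f0).

Let density0 : nu set0 = 0%E. Proof. by rewrite /density_measure integral_set0. Qed.

Let density_ge0 B : (0 <= nu B)%E. Proof. exact: integral_ge0. Qed.

Let density_sigma_additive : semi_sigma_additive nu.
Proof. exact: semi_sigma_additive_nng_induced. Qed.

HB.instance Definition _ := isMeasure.Build _ _ _ nu
  density0 density_ge0 density_sigma_additive.

End density_measure.

Section singularity.
Variables (R : realType) (X : pointedType) (S T : X -> X) (A : set (set X)).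
Hypotheses (SK : cancel S T) (TK : cancel T S).
Local Open Scope ereal_scope.

(** The union of the stages is stable under intersection and generates B, and invariance carries a
    set of any stage into A_0, where the measures agree. *)
Lemma shift_invariant_unique (P1 P2 : probability (full_space S A) R) :
  shift_invariant (S : full_space S A -> full_space S A) P1 ->
  shift_invariant (S : full_space S A -> full_space S A) P2 ->
  (forall B, <<s gen_future S A >> B -> P1 B = P2 B) -> same_measure P1 P2.
Proof.
move=> inv1 inv2 P12 B mB.
have sub : <<s gen_full S A >> `<=` <<s [set C | exists n, stage S A n C] >>.
  by apply: sub_sigma_algebra2 => C; exact: (gen_full_stage SK).
apply: (@g_sigma_algebra_measure_unique _ R (full_space S A)
  [set C | exists n, stage S A n C] _ (fun=> setT)).
- by move=> C [n sC]; exact: (stage_full SK TK sC).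
- by move=> _; exists 0%N; exact: stageT.
- by rewrite bigcup_const.
- move=> C D [n sC] [m sD]; exists (maxn n m).
  apply: stageI.
    by apply: (le_stage SK TK _ sC); rewrite leq_maxl.
  by apply: (le_stage SK TK _ sD); rewrite leq_maxr.
- move=> C [n sC].
  have mS := measurable_full_preimage SK TK (A := A).
  have mC := stage_full SK TK sC.
  transitivity (P1 (iter n S @^-1` C)).
    by apply/esym; exact: (@shift_invariant_iter _ (full_space S A)).
  rewrite P12//; exact: (@shift_invariant_iter _ (full_space S A)).
- by move=> _; rewrite -[X in X < _]/(P1 setT) probability_setT ltry.
- exact: sub.
Qed.

(** Both sides equal the measure of [E] minus that of its intersection with the preimage. *)
Lemma shift_invariant_setD d (Y : measurableType d) (s : Y -> Y)
    (mu : {measure set Y -> \bar R}) (E : set Y) :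
  mu setT < +oo -> shift_invariant s mu -> measurable E ->
  measurable (s @^-1` E) -> mu (E `\` s @^-1` E) = mu (s @^-1` E `\` E).
Proof.
move=> fin inv mE msE.
have lt B : measurable B -> mu B < +oo.
  by move=> mB; apply: le_lt_trans fin; apply: le_measure; rewrite ?inE.
rewrite measureD ?lt// [RHS]measureD ?lt// setIC; congr (_ - _).
exact/esym/inv.
Qed.

Local Notation fut := (@measurable _ (future_space S A)).

Variable phi0 : {finite_measure set (future_space S A) -> \bar R}.
Variables (P1 P2 : probability (full_space S A) R) (Z1 Z2 : X -> R).
Hypotheses (erg1 : shift_ergodic (S : full_space S A -> full_space S A) P1)
  (erg2 : shift_ergodic (S : full_space S A -> full_space S A) P2).
Hypotheses (ZP1 : @RN_version _ (future_space S A) R P1 phi0 Z1)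
  (ZP2 : @RN_version _ (future_space S A) R P2 phi0 Z2).

(* [E = {Z2 < Z1}] is invariant modulo null sets: [P1] and [P2] are invariant,
   so [P1 - P2] takes the same value on the two halves of the symmetric
   difference of [E] and its preimage, being positive on one of them unless it
   is null, and nonpositive on the other. *)
Lemma ergodic_density_separation : ~ same_measure P1 P2 ->
  P1 [set x | (Z2 x < Z1 x)%R] = 1 /\ P2 [set x | (Z2 x < Z1 x)%R] = 0.
Proof.
move=> neq.
pose E : set X := [set x | (Z2 x < Z1 x)%R].
have mE : fut E.
  by apply: measurable_holds; exact: measurable_fun_ltr ZP2.1 ZP1.1.
have mSE : fut (S @^-1` E) by exact: (measurable_future_preimage SK TK mE).
have full B : fut B -> @measurable _ (full_space S A) B by exact: measurable_future_full.
have fin1 : P1 setT \is a fin_num by rewrite probability_setT.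
have fin2 : P2 setT \is a fin_num by rewrite probability_setT.
have mD1 : fut (E `\` S @^-1` E) by exact: measurableD.
have mD2 : fut (S @^-1` E `\` E) by exact: measurableD.
(* On S^-1 E minus E one has Z1 <= Z2, hence P1 <= P2. Invariance moves this inequality to E minus
   S^-1 E, where Z2 < Z1, so that set is null. *)
have phiD : phi0 (E `\` S @^-1` E) = 0.
  apply: (RN_version_lt_null ZP2 ZP1) => //; first by move=> x [].
  rewrite !(@shift_invariant_setD _ (full_space S A) S)//;
    try by [exact: full|exact: erg1.1|exact: erg2.1|rewrite -ge0_fin_numE].
  by apply: (RN_version_le ZP1 ZP2) => // x [_ /negP]; rewrite -leNgt.
have inv (P : probability (full_space S A) R) Zp :
    shift_ergodic (S : full_space S A -> full_space S A) P ->
    @RN_version _ (future_space S A) R P phi0 Zp -> P E = 0 \/ P E = 1.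
  move=> ergP ZP.
  apply: (@ergodic_subinvariant _ (full_space S A) R S) => //.
  - exact: (measurable_full_preimage SK TK).
  - exact: full.
  - exact: (RN_version_null ZP mD1 phiD).
(* Otherwise [E] is null and P1 <= P2 on A_0; taking complements gives equality on A_0, hence on
   B. *)
have lt : P2 E < P1 E.
  rewrite ltNge; apply/negP => le12; apply: neq.
  have E0 : phi0 E = 0 by apply: (RN_version_lt_null ZP2 ZP1).
  have P1E := RN_version_null ZP1 mE E0.
  have le C : fut C -> P1 C <= P2 C.
    move=> mC; have mCE : fut (C `\` E) by exact: measurableD.
    apply: (@le_trans _ _ (P1 (C `\` E))).
      have -> : P1 (C `\` E) = P1 (C `\` E) + P1 E by rewrite P1E adde0.
      apply: le_trans (measureU2 _ (full _ mCE) (full _ mE)).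
      apply: le_measure; rewrite ?inE; [exact: full| |].
        by apply: measurableU; exact: full.
      by move=> x Cx; have [Ex|nEx] := pselect (E x); [right|left].
    apply: (@le_trans _ _ (P2 (C `\` E))).
      apply: (RN_version_le ZP1 ZP2) => // x [_ /negP]; by rewrite -leNgt.
    by apply: le_measure; rewrite ?inE; [exact: full..|exact: subDsetl].
  apply: shift_invariant_unique; [exact: erg1.1|exact: erg2.1|].
  move=> C mC; apply/eqP; rewrite eq_le le//=.
  have := le _ (@measurableC _ (future_space S A) _ mC).
  rewrite !probability_setC; try exact: full.
  have fin (P : probability (full_space S A) R) : P C \is a fin_num.
    by apply: fin_num_measure; exact: full.
  rewrite -(fineK (fin P1)) -(fineK (fin P2)) -!EFinB !lee_fin; lra.
have [P1E|P1E] := inv _ _ erg1 ZP1.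
  by move: lt; rewrite P1E ltNge measure_ge0.
have [P2E|P2E] := inv _ _ erg2 ZP2; first by split.
by move: lt; rewrite P1E P2E ltxx.
Qed.

End singularity.

(** * Ergodic decomposition *)

Section ergodic_components.
Variables (R : realType) (X : pointedType) (S T : X -> X) (A : set (set X)).
Hypotheses (SK : cancel S T) (TK : cancel T S).
Variable phi0 : {finite_measure set (future_space S A) -> \bar R}.
Variable Lambda0 : {finite_measure set (future_space S A) -> \bar R}.
Variables (Z : X -> R) (Z_ge0 : forall x, 0 <= Z x).
Hypothesis Z_version : RN_version Lambda0 phi0 Z.
Variable Lambda : {measure set (full_space S A) -> \bar R}.
Hypothesis Lambda_ext : forall B : set X,
  <<s gen_future S A >> B -> Lambda B = Lambda0 B.
Variables (I : countType) (lambda : I -> R).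
Hypothesis lambda_gt0 : forall i, 0 < lambda i.
Variable Lambda_ : I -> probability (full_space S A) R.
Hypothesis Lambda_ergodic : forall i,
  shift_ergodic (S : full_space S A -> full_space S A) (Lambda_ i).
Hypothesis Lambda_distinct : forall i j, i != j ->
  ~ same_measure (Lambda_ i) (Lambda_ j).
Hypothesis Lambda_decomp : forall B : set (full_space S A), measurable B ->
  Lambda B = (\esum_(i in [set: I]) ((lambda i)%:E * Lambda_ i B))%E.
Variable Z_ : I -> X -> R.
Hypothesis Z__version : forall i,
  @RN_version _ (future_space S A) R (Lambda_ i) phi0 (Z_ i).
Local Open Scope ereal_scope.

Local Notation fut := (@measurable _ (future_space S A)).
Local Notation full := (@measurable _ (full_space S A)).
Local Notation m i := (ess_inf (Lambda_ i) (fun x => (Z_ i x)%:E)).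

Let fut_full B : fut B -> full B.
Proof. exact: measurable_future_full. Qed.

Let fin i : Lambda_ i setT \is a fin_num.
Proof. by rewrite probability_setT. Qed.

Let probability_setC0 i B : full B -> Lambda_ i B = 1 -> Lambda_ i (~` B) = 0.
Proof. by move=> mB B1; rewrite probability_setC// B1 subee. Qed.

(** Strict domination makes these sets disjoint, and by separation Lambda_i lives on the i-th one.
    [nondominant] exhibits the complement as a countable union. *)
Let dominant i : set X := [set x | forall j, j != i -> (Z_ j x < Z_ i x)%R].

Let nondominant i j : set X :=
  if j == i then set0 else ~` [set x | (Z_ j x < Z_ i x)%R].

Let dominantE i : dominant i = ~` \bigcup_j nondominant i j.
Proof.
apply/seteqP; split => x.
  move=> dx [j _]; rewrite /nondominant; case: ifPn => // ji; apply.
  exact: dx.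
move=> nx j ji; apply: contrapT => nlt; apply: nx; exists j => //.
by rewrite /nondominant (negbTE ji).
Qed.

Let mlt i j : fut [set x | (Z_ j x < Z_ i x)%R].
Proof.
apply: measurable_holds.
exact: measurable_fun_ltr (Z__version j).1 (Z__version i).1.
Qed.

Let mnondominant i j : fut (nondominant i j).
Proof.
rewrite /nondominant; case: ifPn => // _.
exact: (@measurableC _ (future_space S A)).
Qed.

Let mdominant i : fut (dominant i).
Proof.
rewrite dominantE; apply: (@measurableC _ (future_space S A)).
exact: (@measurable_countable_bigcup I _ (future_space S A)).
Qed.

Let dominant1 i : Lambda_ i (~` dominant i) = 0.
Proof.
rewrite dominantE setCK.
apply: (@measure_countable_bigcup0 _ (full_space S A)) => j.
  exact: fut_full.
rewrite /nondominant; case: ifPn => [_|ji]; first by rewrite measure0.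
apply: probability_setC0; first exact: fut_full.
apply: (ergodic_density_separation SK TK (Lambda_ergodic i) (Lambda_ergodic j)
  (Z__version i) (Z__version j) _).1.
by apply: Lambda_distinct; rewrite eq_sym.
Qed.

Let dominant0 i j : j != i -> Lambda_ j (dominant i) = 0.
Proof.
move=> ji; have sep : Lambda_ j [set x | (Z_ j x < Z_ i x)%R] = 0.
  apply: (ergodic_density_separation SK TK (Lambda_ergodic i)
    (Lambda_ergodic j) (Z__version i) (Z__version j) _).2.
  by apply: Lambda_distinct; rewrite eq_sym.
by apply: (subset_measure0 _ _ _ sep); [exact: fut_full..|move=> x; exact].
Qed.

Let Lambda0_dominant i B : fut B -> B `<=` dominant i ->
  Lambda0 B = (lambda i)%:E * Lambda_ i B.
Proof.
move=> mB Bi; rewrite -Lambda_ext// Lambda_decomp; last exact: fut_full.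
apply: esum_single => [j ji|]; last by rewrite mule_ge0// lee_fin ltW.
rewrite (_ : Lambda_ j B = 0) ?mule0//.
apply: (@subset_measure0 _ (full_space S A) _ (Lambda_ j) B (dominant i)) => //;
  try exact: fut_full.
exact: dominant0.
Qed.

Let scaled_version i : @RN_version _ (future_space S A) R
  (fun B => (lambda i)%:E * Lambda_ i B) phi0 (fun x => (lambda i * Z_ i x)%R).
Proof.
have [mZ ZE] := Z__version i; split; first exact: measurable_funM.
move=> B mB; rewrite ZE// -integralZl//.
apply: (@integrableS _ _ _ _ setT) => //.
exact: RN_version_integrable (Z__version i) (fin i).
Qed.

Let mismatch i : set X := dominant i `&` [set x | Z x != (lambda i * Z_ i x)%R].

Let mmismatch i : fut (mismatch i).
Proof.
apply: (@measurableI _ (future_space S A)) => //.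
rewrite (_ : [set x | _] = ~` [set x | Z x == (lambda i * Z_ i x)%R]); last first.
  by apply/seteqP; split => x /= /negP.
apply: (@measurableC _ (future_space S A)); apply: measurable_holds.
exact: measurable_fun_eqr Z_version.1 (scaled_version i).1.
Qed.

(** Inside [dominant i] the measures with densities Z and lambda_i Z_i coincide, so neither density
    exceeds the other on a set of positive phi0-measure. *)
Let mismatch0 i : Lambda_ i (mismatch i) = 0.
Proof.
apply: (RN_version_null (Z__version i)) => //.
pose lo : set X := dominant i `&` [set x | (Z x < lambda i * Z_ i x)%R].
pose hi : set X := dominant i `&` [set x | (lambda i * Z_ i x < Z x)%R].
have mlo : fut lo.
  apply: (@measurableI _ (future_space S A)) => //; apply: measurable_holds.
  exact: measurable_fun_ltr Z_version.1 (scaled_version i).1.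
have mhi : fut hi.
  apply: (@measurableI _ (future_space S A)) => //; apply: measurable_holds.
  exact: measurable_fun_ltr (scaled_version i).1 Z_version.1.
have finZ : Lambda0 setT \is a fin_num by exact: fin_num_measure.
have fins : (lambda i)%:E * Lambda_ i setT \is a fin_num by rewrite fin_numM.
have lo0 : phi0 lo = 0.
  apply: (RN_version_lt_null Z_version (scaled_version i)) => //.
    by move=> x [].
  by rewrite (@Lambda0_dominant i)//; exact: subIsetl.
have hi0 : phi0 hi = 0.
  apply: (RN_version_lt_null (scaled_version i) Z_version) => //.
    by move=> x [].
  by rewrite (@Lambda0_dominant i)//; exact: subIsetl.
have mU : fut (lo `|` hi) by exact: measurableU.
apply: (subset_measure0 (mmismatch i) mU).
  by move=> x [dx] /=; rewrite neq_lt => /orP[]; [left|right].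
exact: etrans (measureU0 mlo mhi hi0) lo0.
Qed.

Let below i : set X := ~` [set x | m i <= (Z_ i x)%:E].

Let mbelow i : fut (below i).
Proof.
apply: (@measurableC _ (future_space S A)).
rewrite -[X in _ X]setTI.
apply: (@measurable_lee _ (future_space S A) R _ measurableT (cst (m i))) => //.
by apply/measurable_EFinP; exact: (Z__version i).1.
Qed.

Let below0 i : Lambda_ i (below i) = 0.
Proof.
apply/negligibleP; first exact: fut_full.
exact: (@ess_inf_le _ _ _ (Lambda_ i) (fun x => (Z_ i x)%:E)).
Qed.

(** Discarding two null sets makes Z = lambda_i Z_i and m_i <= Z_i true at every point, not just
    almost everywhere. *)
Definition ergodic_component i : set X := dominant i `\` (mismatch i `|` below i).

Local Notation B := ergodic_component.

Lemma measurable_ergodic_component i : fut (B i).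
Proof. by apply: measurableD => //; exact: measurableU. Qed.

Lemma trivIset_ergodic_component : trivIset setT B.
Proof.
move=> i j _ _ [x [[di _] [dj _]]]; apply: contrapT => /eqP ij.
have ji : j != i by rewrite eq_sym.
by have := lt_trans (di j ji) (dj i ij); rewrite ltxx.
Qed.

Lemma ergodic_component1 i E : fut E -> Lambda_ i (E `&` B i) = Lambda_ i E.
Proof.
move=> mE; apply/eqP; rewrite eq_le; apply/andP; split.
  apply: le_measure; rewrite ?inE; [|exact: fut_full|exact: subIsetl].
  apply: fut_full; apply: measurableI => //; exact: measurable_ergodic_component.
have mI : full (E `&` B i).
  by apply: fut_full; apply: measurableI => //; exact: measurable_ergodic_component.
have N0 : Lambda_ i (~` dominant i `|` (mismatch i `|` below i)) = 0.
  have mU : full (mismatch i `|` below i) by apply: fut_full; exact: measurableU.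
  have mD : full (~` dominant i).
    by apply: fut_full; exact: (@measurableC _ (future_space S A)).
  apply: etrans (measureU0 mD mU _) (dominant1 i).
  apply: etrans (measureU0 _ _ (below0 i)) (mismatch0 i); exact: fut_full.
have mN : full (~` dominant i `|` (mismatch i `|` below i)).
  apply: fut_full; apply: measurableU; last exact: measurableU.
  exact: (@measurableC _ (future_space S A)).
have -> : Lambda_ i (E `&` B i) = Lambda_ i (E `&` B i) +
    Lambda_ i (~` dominant i `|` (mismatch i `|` below i)) by rewrite N0 adde0.
apply: le_trans (measureU2 _ mI mN).
apply: le_measure; rewrite ?inE; [exact: fut_full|exact: measurableU|].
move=> x Ex; have [dx|ndx] := pselect (dominant i x); last by right; left.
by have [Nx|nNx] := pselect ((mismatch i `|` below i) x); [right; right|left].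
Qed.

Lemma ergodic_component_density i x : B i x -> Z x = (lambda i * Z_ i x)%R.
Proof.
move=> [dx /not_orP[nx _]]; apply/eqP; apply: contrapT => /negP nZ.
exact: nx.
Qed.

Lemma ergodic_component_inf i x : B i x -> m i <= (Z_ i x)%:E.
Proof. by move=> [_ /not_orP[_ /contrapT]]. Qed.

Lemma Lambda0_ergodic_component i E : fut E -> E `<=` B i ->
  Lambda0 E = (lambda i)%:E * Lambda_ i E.
Proof. by move=> mE EB; apply: Lambda0_dominant => // x /EB[]. Qed.

(** On the component Z_i equals Z / lambda_i, whence the sign; the component is nonempty, and the
    value of Z_i at one of its points bounds m_i. *)
Lemma ess_inf_density_fin_num i : 0 <= m i /\ m i \is a fin_num.
Proof.
have m0 : 0 <= m i.
  apply/ess_infP.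
  exists (~` B i); split.
  - by apply: fut_full; apply: (@measurableC _ (future_space S A));
      exact: measurable_ergodic_component.
  - apply: probability_setC0.
      by apply: fut_full; exact: measurable_ergodic_component.
    by rewrite -(setTI (B i)) ergodic_component1// probability_setT.
  - move=> x /= nx Bx; apply: nx.
    suff : (0 <= Z_ i x)%R by rewrite -lee_fin.
    by rewrite -(pmulr_rge0 _ (lambda_gt0 i)) -ergodic_component_density.
split => //; rewrite ge0_fin_numE//.
have [x Bx] : exists x, B i x.
  apply/not_existsP => nB; have /eqP := probability_setT (Lambda_ i).
  rewrite -(@ergodic_component1 i setT)// setTI.
  rewrite (_ : B i = set0) ?measure0 ?eqe 1?eq_sym ?oner_eq0//.
  by rewrite -subset0 => x /nB.
exact: le_lt_trans (ergodic_component_inf Bx) (ltry _).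
Qed.

(** * Comparison of the integral of Z^alpha with the weighted mixture *)

Variables alpha gamma : R.
Hypothesis alpha_itv : (1 <= alpha <= gamma)%R.
Hypothesis Z_int : \int[Lambda0]_x (Z x `^ (gamma - 1))%:E < +oo.
Hypothesis Lambda0_ac : Lambda0 `<< phi0.
Hypothesis Lambda_inv :
  shift_invariant (S : full_space S A -> full_space S A) Lambda.
Hypothesis Lambda_prob : Lambda [set: X] = 1.

Let mpowr r : measurable_fun setT ((fun x => Z x `^ r)%R : future_space S A -> R).
Proof. by have := measurableT_comp (@measurable_powR R r) Z_version.1; exact. Qed.

Let mpow r : measurable_fun setT
  ((fun x => (Z x `^ r)%:E) : future_space S A -> \bar R).
Proof. by apply/measurable_EFinP; exact: mpowr. Qed.

Let pow_ge0 r x : 0 <= (Z x `^ r)%:E. Proof. by rewrite lee_fin powR_ge0. Qed.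

Let cost : {measure set (future_space S A) -> \bar R} :=
  density_measure phi0 (mpow alpha) (pow_ge0 alpha).

Let costE E : cost E = \int[phi0]_(x in E) (Z x `^ alpha)%:E.
Proof. by []. Qed.

(** Taking [fine] is harmless since m_i is finite; for alpha = 1 the weight is 1 even if m_i = 0. *)
Let w i : R := (lambda i * fine (m i)) `^ (alpha - 1).

Let alpha_gt0 : (0 < alpha)%R. Proof. by case/andP: alpha_itv => + _; lra. Qed.

Let mZ E : fut E -> measurable_fun (E : set (future_space S A)) (fun x => (Z x)%:E).
Proof.
by move=> mE; apply: measurable_funTS; apply/measurable_EFinP; exact: Z_version.1.
Qed.

Let mtZ t E : fut E ->
  measurable_fun (E : set (future_space S A)) (fun x => (t * Z x)%:E).
Proof.
move=> mE; apply: measurable_funTS; apply/measurable_EFinP.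
by apply: measurable_funM => //; exact: Z_version.1.
Qed.

Let Lambda0Z (t : R) E : fut E -> (0 <= t)%R ->
  t%:E * Lambda0 E = \int[phi0]_(x in E) (t * Z x)%:E.
Proof.
move=> mE t0; rewrite Z_version.2// -ge0_integralZl//.
- exact: mZ.
- by move=> x _; rewrite lee_fin.
Qed.

(** Z^alpha is Z times Z^(alpha-1), and the second factor is at least w_i on the component. *)
Let cost_ge i E : fut E -> E `<=` B i -> (w i)%:E * Lambda0 E <= cost E.
Proof.
move=> mE EB; rewrite Lambda0Z ?powR_ge0// costE; apply: ge0_le_integral => //.
- by move=> x _; rewrite lee_fin mulr_ge0// powR_ge0.
- exact: mtZ.
- exact: measurable_funTS (mpow alpha).
move=> x /EB Bx; rewrite lee_fin -(mulr_powRB1 (Z_ge0 x) alpha_gt0) mulrC ler_wpM2l//.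
have [m0 mfin] := ess_inf_density_fin_num i.
apply: ge0_ler_powR; rewrite ?nnegrE//.
- by case/andP: alpha_itv => + _; lra.
- by rewrite mulr_ge0 ?fine_ge0// ltW.
rewrite (ergodic_component_density Bx) ler_pM2l// -lee_fin fineK//.
exact: ergodic_component_inf.
Qed.

Let cost_le (t : R) E : fut E -> (0 <= t)%R ->
  (forall x, E x -> (Z x `^ (alpha - 1) <= t)%R) -> cost E <= t%:E * Lambda0 E.
Proof.
move=> mE t0 Et; rewrite Lambda0Z// costE; apply: ge0_le_integral => //.
- exact: measurable_funTS (mpow alpha).
- exact: mtZ.
by move=> x /Et Zt; rewrite lee_fin -(mulr_powRB1 (Z_ge0 x) alpha_gt0) mulrC ler_wpM2r//.
Qed.

(** A Lambda0-null set may have positive phi0-measure, but Z vanishes phi0-almost everywhere on it,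
    and 0^alpha = 0 as alpha > 0. *)
Let cost_null E : fut E -> Lambda0 E = 0 -> cost E = 0.
Proof.
move=> mE; rewrite Z_version.2// => Z0.
have aeZ : ae_eq phi0 E (fun x => (Z x)%:E) (cst 0).
  apply/(ae_eq_integral_abs phi0 mE (mZ mE)); rewrite -[RHS]Z0.
  by apply: eq_integral => x _; rewrite gee0_abs// lee_fin.
rewrite costE -(integral0 phi0 E); apply: ae_eq_integral => //.
- exact: measurable_funTS (mpow alpha).
apply: filterS aeZ => x /= Zx Ex; have [Z0x] := Zx Ex.
by rewrite Z0x powR0// gt_eqF.
Qed.

Let cost_finite : cost setT < +oo.
Proof.
have ag : (alpha - 1 <= gamma - 1)%R by case/andP: alpha_itv => _; lra.
have gamma0 : (0 < gamma)%R by case/andP: alpha_itv; lra.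
have gfin : \int[phi0]_x (Z x `^ gamma)%:E < +oo.
  (* The derivative [f] agrees with Z almost everywhere, so a change of variables turns the integral
     of Z^gamma against phi0 into that of Z^(gamma-1) against Lambda0. *)
  pose f := Radon_Nikodym_SigmaFinite.f Lambda0 phi0.
  have fZ : ae_eq phi0 setT f (EFin \o Z).
    apply: integral_ae_eq => //.
    - exact: Radon_Nikodym_SigmaFinite.f_integrable.
    - exact: mZ.
    - move=> E _ mE.
      by rewrite -Radon_Nikodym_SigmaFinite.f_integral// Z_version.2.
  rewrite (_ : \int[phi0]_x (Z x `^ gamma)%:E =
      \int[Lambda0]_x (Z x `^ (gamma - 1))%:E)//.
  rewrite -(Radon_Nikodym_SigmaFinite.change_of_variables Lambda0_ac
    (pow_ge0 (gamma - 1)) measurableT (mpow _)).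
  apply: ae_eq_integral => //.
  - apply: emeasurable_funM; first exact: mpow.
    exact: measurable_int (Radon_Nikodym_SigmaFinite.f_integrable Lambda0_ac).
  - apply: filterS fZ => x /= /(_ Logic.I) fx _.
    rewrite -[X in _ = _ * X]/(f x) fx.
    by rewrite -EFinM mulrC mulr_powRB1.
(* Z^alpha <= Z + Z^gamma: the first term suffices where Z <= 1, the second where Z > 1. *)
rewrite costE; apply: (@le_lt_trans _ _
    (\int[phi0]_x ((Z x)%:E + (Z x `^ gamma)%:E))).
  apply: ge0_le_integral => //.
    by apply: emeasurable_funD; [exact: mZ|exact: mpow].
  move=> x _; rewrite -EFinD lee_fin.
  have [Z1|Z1] := leP (Z x) 1%R.
    rewrite -[leLHS]addr0 lerD ?powR_ge0//.
    have [->|Z0] := eqVneq (Z x) 0%R; first by rewrite powR0 ?gt_eqF.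
    apply: ge1r_powR; last by case/andP: alpha_itv.
    by rewrite lt_neqAle eq_sym Z0 Z_ge0.
  rewrite -[leLHS]add0r lerD//; apply: ler_powR; first exact: ltW.
  by case/andP: alpha_itv.
rewrite ge0_integralD//; last 2 first.
- by move=> x _; rewrite lee_fin.
- exact: mZ.
rewrite lte_add_pinfty// -Z_version.2//.
by rewrite -ge0_fin_numE// fin_num_measure.
Qed.

Let nng_weight i : (0 <= lambda i * w i)%R.
Proof. by rewrite mulr_ge0 ?powR_ge0// ltW. Qed.

Let nu : {measure set (full_space S A) -> \bar R} :=
  mixture (fun i => NngNum (nng_weight i)) (fun i => Lambda_ i).

Let nuE E : nu E = \esum_(i in [set: I]) ((lambda i * w i)%:E * Lambda_ i E).
Proof. by rewrite /nu mixtureE. Qed.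

Let nu_inv : shift_invariant (S : full_space S A -> full_space S A) nu.
Proof.
move=> E mE; rewrite !nuE; apply: eq_esum => i _.
by rewrite (Lambda_ergodic i).1.
Qed.

Let mEB i E : fut E -> fut (E `&` B i).
Proof. by move=> mE; apply: measurableI => //; exact: measurable_ergodic_component. Qed.

Let cost_bigcupB E : fut E ->
  cost (\bigcup_i (E `&` B i)) = \esum_(i in [set: I]) cost (E `&` B i).
Proof.
move=> mE; apply: measure_countable_bigcup => [i|]; first exact: mEB.
by apply: trivIset_setIl; exact: trivIset_ergodic_component.
Qed.

(** The part of [E] outside all components is dropped from the cost; no Lambda_i loses mass, since
    each lives on its own component. *)
Let nu_le_cost E : fut E -> nu E <= cost E.
Proof.
move=> mE; apply: (@le_trans _ _ (cost (\bigcup_i (E `&` B i)))).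
  rewrite nuE cost_bigcupB//; apply: le_esum => i _.
  apply: le_trans (cost_ge (mEB i mE) (@subIsetr _ _ _)).
  rewrite (Lambda0_ergodic_component (mEB i mE) (@subIsetr _ _ _)).
  by rewrite ergodic_component1// muleA -EFinM mulrC.
apply: le_measure; rewrite ?inE//.
  by apply: measurable_countable_bigcup => i; exact: mEB.
by move=> x [i _ []].
Qed.

Let hit (delta : R) i : set X := B i `&` [set x | (Z x `^ (alpha - 1) <= w i + delta)%R].

Let mhit delta i : fut (hit delta i).
Proof.
apply: (@measurableI _ (future_space S A)).
  exact: measurable_ergodic_component.
by apply: measurable_holds; exact: measurable_fun_ler.
Qed.

(** Otherwise Z_i would be at least some t > m_i almost everywhere for Lambda_i, against the choice
    of m_i. *)
Let hit_gt0 delta i : (0 < delta)%R -> Lambda_ i (hit delta i) != 0.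
Proof.
move=> delta0; apply/eqP => hit0.
have [m0 mfin] := ess_inf_density_fin_num i.
(* For alpha = 1 the power Z^(alpha-1) is constantly 1 and cannot be inverted, but then the hit set
   is the whole component. *)
have [a1|a1] := eqVneq alpha 1%R.
  have := ergodic_component1 i measurableT.
  rewrite setTI probability_setT (_ : B i = hit delta i).
    by rewrite hit0 => /eqP; rewrite eqe eq_sym oner_eq0.
  apply/seteqP; split => [x Bx|x []//]; split => //=.
  by rewrite /w a1 subrr !powRr0 lerDl ltW.
have a0 : (0 < alpha - 1)%R.
  by rewrite subr_gt0 lt_neqAle eq_sym a1; case/andP: alpha_itv.
have a0' : (0 < (alpha - 1)^-1)%R by rewrite invr_gt0.
have powK z : (0 <= z)%R -> ((z `^ (alpha - 1)) `^ (alpha - 1)^-1 = z)%R.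
  by move=> z0; rewrite -powRrM divff ?gt_eqF// powRr1.
(* [t] solves (lambda_i t)^(alpha-1) = w_i + delta. *)
pose t := ((w i + delta) `^ (alpha - 1)^-1 / lambda i)%R.
have : t%:E <= m i.
  apply/ess_infP; exists (~` B i `|` hit delta i); split.
  - apply: fut_full; apply: measurableU => //.
    by apply: measurableC; exact: measurable_ergodic_component.
  - apply: etrans (measureU0 _ _ hit0) _.
    + by apply: fut_full; apply: (@measurableC _ (future_space S A));
        exact: measurable_ergodic_component.
    + exact: fut_full.
    apply: probability_setC0.
      by apply: fut_full; exact: measurable_ergodic_component.
    by rewrite -(setTI (B i)) ergodic_component1// probability_setT.
  - move=> x /= nt; have [Bx|] := pselect (B i x); last by left.
    right; split => //=; rewrite leNgt; apply/negP => lt.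
    apply: nt; rewrite lee_fin /t ler_pdivrMr// mulrC.
    rewrite -(ergodic_component_density Bx) -(powK (Z x))//.
    by apply: ge0_ler_powR; rewrite ?nnegrE ?addr_ge0 ?powR_ge0 ?ltW.
apply/negP; rewrite -ltNge -(fineK mfin) lte_fin /t ltr_pdivlMr// mulrC.
have lm0 : (0 <= lambda i * fine (m i))%R by rewrite mulr_ge0 ?fine_ge0// ltW.
rewrite -[ltLHS](powK _ lm0).
apply: gt0_ltr_powR; rewrite ?nnegrE ?addr_ge0 ?powR_ge0 ?ltW//.
by rewrite ltrDl.
Qed.

Let cost_approx (delta : R) : (0 < delta)%R -> exists D,
  [/\ fut D, (forall E, fut E -> E `<=` D -> cost E <= nu E + delta%:E * Lambda E)
    & cost (\bigcap_n iter n S @^-1` (~` D)) = 0].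
Proof.
move=> delta0; exists (\bigcup_i hit delta i).
have mD : fut (\bigcup_i hit delta i).
  exact: (@measurable_countable_bigcup I _ (future_space S A)).
split => //.
  move=> E mE ED; have EB : E = \bigcup_i (E `&` B i).
    apply/seteqP; split => [x Ex|x [i _ []]//].
    by have [i _ [Bx _]] := ED x Ex; exists i.
  rewrite [in leLHS]EB cost_bigcupB// nuE Lambda_decomp; last exact: fut_full.
  rewrite -ge0_esumZl//; last 2 first.
  - exact: ltW.
  - by move=> i; rewrite mule_ge0// lee_fin ltW.
  rewrite -esumD; last 2 first.
  - by move=> i _; rewrite mule_ge0// lee_fin.
  - by move=> i _; rewrite !mule_ge0// lee_fin ltW.
  apply: le_esum => i _.
  apply: (@le_trans _ _ ((w i + delta)%:E * Lambda0 (E `&` B i))).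
    apply: cost_le => [||x [Ex Bx]]; first exact: mEB.
      by rewrite addr_ge0 ?powR_ge0// ltW.
    (* The point is in a hit set of some index j; disjointness of the components identifies j with
       i. *)
    have [j _ [Bjx]] := ED x Ex; suff -> : i = j by [].
    by apply: (@trivIset_ergodic_component i j) => //; exists x.
  rewrite (Lambda0_ergodic_component (mEB i mE) (@subIsetr _ _ _)).
  rewrite ergodic_component1// !muleA -!EFinM -ge0_muleDl ?lee_fin ?mulr_ge0//;
    try by [exact: ltW|exact: powR_ge0].
  by rewrite -EFinD mulrDl mulrC.
(* [F] lies in its own preimage, so each Lambda_i gives it mass 0 or 1; mass 1 is impossible, as [F]
   misses [hit delta i], which has positive measure. *)
pose F := \bigcap_n iter n S @^-1` (~` \bigcup_i hit delta i).
have mF : fut F.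
  apply: (@bigcapT_measurable _ (future_space S A)) => n.
  apply: (@measurable_iter_preimage _ (future_space S A)).
    exact: measurable_future_preimage SK TK.
  exact: (@measurableC _ (future_space S A)).
apply: (cost_null mF); rewrite -Lambda_ext// Lambda_decomp; last exact: fut_full.
apply: esum1 => i _; rewrite (_ : Lambda_ i F = 0) ?mule0//.
have F0 : Lambda_ i (F `\` S @^-1` F) = 0.
  rewrite (_ : F `\` _ = set0) ?measure0// -subset0 => x [Fx]; apply=> n _ /=.
  by rewrite -iterSr; exact: (Fx n.+1).
have [//|F1] := @ergodic_subinvariant _ (full_space S A) R S
  (measurable_full_preimage SK TK (A := A)) (Lambda_ i) F
  (Lambda_ergodic i) (fut_full mF) F0.
exfalso; move/eqP: (hit_gt0 i delta0); apply.
apply: (@subset_measure0 _ (full_space S A) _ (Lambda_ i) _ (~` F)).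
- exact: fut_full.
- by apply: fut_full; exact: (@measurableC _ (future_space S A)).
- by move=> x hx Fx; apply: (Fx 0%N) => //=; exists i.
- by apply: probability_setC0 => //; exact: fut_full.
Qed.

Lemma H_alpha_ergodic_decomposition (Q : set (full_space S A)) : full Q ->
  H_alpha phi0 Z alpha Q =
  \esum_(i in [set: I])
     ((lambda i `^ alpha)%:E * (m i `^ (alpha - 1)) * Lambda_ i Q).
Proof.
move=> mQ; transitivity (nu Q).
  apply: (ereal_inf_covers SK TK cost_finite nu_inv Lambda_inv) => //.
  by rewrite Lambda_prob.
(* It remains to see that lambda_i (lambda_i m_i)^(alpha-1) = lambda_i^alpha m_i^(alpha-1). *)
rewrite nuE; apply: eq_esum => i _; congr (_ * _).
have [m0 mfin] := ess_inf_density_fin_num i.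
rewrite -[in RHS](fineK mfin) /= -EFinM /w powRM ?fine_ge0//; last exact: ltW.
by rewrite mulrA mulr_powRB1// ltW.
Qed.

End ergodic_components.

Theorem theorem11 (R : realType) (X : pointedType) (S : X -> X)
    (S_bij : bijective S)
    (A : set (set X)) (A_sigma : sigma_algebra [set: X] A)
    (phi0 : {finite_measure set (future_space S A) -> \bar R})
    (Lambda0 : {finite_measure set (future_space S A) -> \bar R})
    (Lambda0_inv : shift_invariant (S : future_space S A -> future_space S A) Lambda0)
    (Lambda0_ac : Lambda0 `<< phi0)
    (Z : X -> R) (Z_ge0 : forall x, 0 <= Z x)
    (Z_version : RN_version Lambda0 phi0 Z)
    (Lambda : {measure set (full_space S A) -> \bar R})
    (Lambda_inv : shift_invariant (S : full_space S A -> full_space S A) Lambda)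
    (Lambda_ext : forall B : set X,
       <<s gen_future S A >> B -> Lambda B = Lambda0 B)
    (Lambda_prob : Lambda [set: X] = 1%E)
    (I : countType) (lambda : I -> R)
    (lambda_itv : forall i, 0 < lambda i <= 1)
    (Lambda_ : I -> probability (full_space S A) R)
    (Lambda_ergodic : forall i,
       shift_ergodic (S : full_space S A -> full_space S A) (Lambda_ i))
    (Lambda_distinct : forall i j, i != j ->
       ~ same_measure (Lambda_ i) (Lambda_ j))
    (Lambda_decomp : forall B : set (full_space S A), measurable B ->
       Lambda B = (\esum_(i in [set: I]) ((lambda i)%:E * Lambda_ i B))%E)
    (Z_ : I -> X -> R)
    (Z__version : forall i,
       @RN_version _ (future_space S A) R (Lambda_ i) phi0 (Z_ i))
    (gamma : R) (gamma_gt1 : 1 < gamma)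
    (Z_int : (\int[Lambda0]_x (Z x `^ (gamma - 1))%:E < +oo)%E)
    (Q : set (full_space S A)) (Q_meas : measurable Q)
    (alpha : R) (alpha_itv : 1 <= alpha <= gamma) :
  H_alpha phi0 Z alpha Q =
  (\esum_(i in [set: I])
     ((lambda i `^ alpha)%:E *
      (ess_inf (Lambda_ i) (fun x => (Z_ i x)%:E) `^ (alpha - 1)) *
      Lambda_ i Q))%E.
Proof.
have [T SK TK] := S_bij.
apply: (@H_alpha_ergodic_decomposition R X S T A SK TK phi0 Lambda0 Z Z_ge0
  Z_version Lambda Lambda_ext I lambda _ Lambda_ Lambda_ergodic Lambda_distinct
  Lambda_decomp Z_ Z__version alpha gamma) => //.
by move=> i; case/andP: (lambda_itv i).
Qed.
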